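(* Let $A$ be a compact subset of $\mathbb{R}^m$, and let $r_1,\ldots,r_m\in\mathbb{R}^m$ be affinely independent points such that either $A\subset H^-$ or $A\subset H^+$, where $H^-,H^+$ are the two open halfspaces delimited by the affine hyperplane $\operatorname{Aff}(r_1,\ldots,r_m)$. Let $F_r^1:\mathbb{R}^m\to\mathbb{R}^m$ be given by $F_r^1(x)=(\|x-r_1\|,\ldots,\|x-r_m\|)$. Let $$\mu=\max_{x\in A}\max_{i\neq j}\left|\left\langle\frac{x-r_i}{\|x-r_i\|},\frac{x-r_j}{\|x-r_j\|}\right\rangle\right|$$ and let $d(r,A)=\min_{i=1,\ldots,m} d(r_i,A)$. If $B$ is any ball of radius $\rho>0$ with $B\subset A$ and $$\frac{\rho}{d(r,A)}<\frac{1-(m-1)\mu}{\sqrt{m}},$$ then $F_r^1(B)$ is convex in $\mathbb{R}^m$.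
   Context: $\mathbb{R}^m$ carries the standard Euclidean inner product $\langle\cdot,\cdot\rangle$ and norm $\|\cdot\|$; $d(r_i,A)=\min_{a\in A}\|r_i-a\|$ is the Euclidean distance from the point $r_i$ to $A$; $\operatorname{Aff}$ is the affine hull. *)

(* Defs.v *)
From mathcomp Require Import all_boot all_order all_algebra.
From mathcomp Require Import all_classical all_reals all_analysis.

Set Implicit Arguments.
Unset Strict Implicit.
Unset Printing Implicit Defensive.

Import Order.TTheory GRing.Theory Num.Theory.
Import numFieldNormedType.Exports.

Local Open Scope classical_set_scope.
Local Open Scope ring_scope.

(* The norm that MathComp-Analysis puts on 'rV[R]_m is the sup norm, so the
   Euclidean structure is defined here; the product topology on 'rV[R]_m is
   the Euclidean one and is used as is. *)

Definition dot (R : realType) (m : nat) (u v : 'rV[R]_m) : R :=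
  \sum_(k < m) u 0 k * v 0 k.

Definition enorm (R : realType) (m : nat) (u : 'rV[R]_m) : R :=
  Num.sqrt (dot u u).

Definition open_eball (R : realType) (m : nat) (a : 'rV[R]_m) (rho : R)
    : set 'rV[R]_m :=
  [set x | enorm (x - a) < rho].

Definition closed_eball (R : realType) (m : nat) (a : 'rV[R]_m) (rho : R)
    : set 'rV[R]_m :=
  [set x | enorm (x - a) <= rho].

Definition affinely_independent (R : realType) (m n : nat)
    (r : 'I_n -> 'rV[R]_m) : Prop :=
  forall w : 'I_n -> R,
    \sum_(i < n) w i = 0 -> \sum_(i < n) w i *: r i = 0 -> forall i, w i = 0.

Definition Aff (R : realType) (m n : nat) (r : 'I_n -> 'rV[R]_m)
    : set 'rV[R]_m :=
  [set x | exists w : 'I_n -> R,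
     \sum_(i < n) w i = 1 /\ x = \sum_(i < n) w i *: r i].

Definition hyperplane (R : realType) (m : nat) (u : 'rV[R]_m) (c : R)
    : set 'rV[R]_m :=
  [set x | dot u x = c].

Definition halfspace_neg (R : realType) (m : nat) (u : 'rV[R]_m) (c : R)
    : set 'rV[R]_m :=
  [set x | dot u x < c].

Definition halfspace_pos (R : realType) (m : nat) (u : 'rV[R]_m) (c : R)
    : set 'rV[R]_m :=
  [set x | c < dot u x].

Definition range_map (R : realType) (m n : nat) (r : 'I_n -> 'rV[R]_m)
    (x : 'rV[R]_m) : 'rV[R]_n :=
  \row_(i < n) enorm (x - r i).

Definition unit_dir (R : realType) (m : nat) (p x : 'rV[R]_m) : 'rV[R]_m :=
  (enorm (x - p))^-1 *: (x - p).

(* The maxima and minima below are rendered by [sup] and [inf]: they agree for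
   A nonempty, compact and disjoint from the r_i.  For a single point (n = 1)
   there is no pair i <> j, and [sup] of the empty set is 0. *)

Definition mutual_coherence (R : realType) (m n : nat) (r : 'I_n -> 'rV[R]_m)
    (A : set 'rV[R]_m) : R :=
  sup [set t | exists x i j, [/\ A x, i != j &
         t = `| dot (unit_dir (r i) x) (unit_dir (r j) x) |]].

Definition dist_to (R : realType) (m : nat) (p : 'rV[R]_m)
    (A : set 'rV[R]_m) : R :=
  inf [set enorm (p - a) | a in A].

Definition dist_family (R : realType) (m n : nat) (r : 'I_n -> 'rV[R]_m)
    (A : set 'rV[R]_m) : R :=
  inf (range (fun i => dist_to (r i) A)).

(* Main.v *)
(* Polyak's argument.  For [x], [y] in [B] and [z = t x + (1 - t) y], put
   [q = t (1 - t) |x - y|^2].  Uniform convexity of the ball puts the closed ball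
   [K] of radius [q / (2 rho)] around [z] inside [B], while the second-order
   expansion of the norm gives
   [|F z - (t F x + (1 - t) F y)| <= sqrt m * q / (2 d)].
   The Jacobian [J] of [F] has unit rows with pairwise products at most [mu], so
   [J J^T >= lam = 1 - (m - 1) mu] by diagonal dominance; hence [F] maps [K] onto
   a set containing every point at distance less than [k q / (2 rho)] from [F z]
   as soon as [k^2 < lam].  As [lam <= 1], the hypothesis
   [sqrt m * rho / d < lam] leaves room for such a [k]. *)

Require Import Defs.
From mathcomp Require Import all_boot all_order all_algebra.
From mathcomp Require Import all_classical all_reals all_analysis.
From mathcomp Require Import ring lra.

Set Implicit Arguments.
Unset Strict Implicit.
Unset Printing Implicit Defensive.

Import Order.TTheory GRing.Theory Num.Theory.
Import numFieldNormedType.Exports.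

Local Open Scope classical_set_scope.
Local Open Scope ring_scope.

(** * Euclidean inner product and norm *)

Section Euclidean.
Variables (R : realType) (m : nat).
Implicit Types (u v w h : 'rV[R]_m) (k : R).

Lemma dotC u v : dot u v = dot v u.
Proof. by apply: eq_bigr => i _; rewrite mulrC. Qed.

Lemma dotDl u v w : dot (u + v) w = dot u w + dot v w.
Proof. by rewrite -big_split; apply: eq_bigr => i _ /=; rewrite mxE mulrDl. Qed.

Lemma dotZl k u v : dot (k *: u) v = k * dot u v.
Proof. by rewrite mulr_sumr; apply: eq_bigr => i _; rewrite mxE mulrA. Qed.

Lemma dotDr u v w : dot u (v + w) = dot u v + dot u w.
Proof. by rewrite !(dotC u) dotDl. Qed.

Lemma dotZr k u v : dot u (k *: v) = k * dot u v.
Proof. by rewrite !(dotC u) dotZl. Qed.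

Lemma dotNl u v : dot (- u) v = - dot u v.
Proof. by rewrite -scaleN1r dotZl mulN1r. Qed.

Lemma dot0l v : dot 0 v = 0.
Proof. by rewrite -(scale0r v) dotZl mul0r. Qed.

Lemma dot_suml n (F : 'I_n -> 'rV[R]_m) v :
  dot (\sum_i F i) v = \sum_i dot (F i) v.
Proof.
rewrite exchange_big; apply: eq_bigr => k _ /=.
by rewrite summxE mulr_suml.
Qed.

Lemma dot_ge0 u : 0 <= dot u u.
Proof. by apply: sumr_ge0 => i _; rewrite -expr2 sqr_ge0. Qed.

Lemma enorm_ge0 u : 0 <= enorm u. Proof. exact: sqrtr_ge0. Qed.

Lemma enorm_sqr u : enorm u ^+ 2 = dot u u.
Proof. exact: sqr_sqrtr (dot_ge0 u). Qed.

Lemma enorm_eq0 u : (enorm u == 0) = (u == 0).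
Proof.
rewrite -sqrf_eq0 enorm_sqr psumr_eq0 => [|i _]; last by rewrite -expr2 sqr_ge0.
apply/allP/eqP => [u0|-> i _]; last by rewrite mxE mul0r eqxx.
apply/rowP => i; rewrite mxE; apply/eqP.
by have := u0 i (mem_index_enum i); rewrite /= mulf_eq0 orbb.
Qed.

Lemma enorm0 : enorm (0 : 'rV[R]_m) = 0.
Proof. by apply/eqP; rewrite enorm_eq0. Qed.

Lemma enorm_gt0 u : (0 < enorm u) = (u != 0).
Proof. by rewrite lt_def enorm_eq0 enorm_ge0 andbT. Qed.

Lemma enormZ k u : enorm (k *: u) = `|k| * enorm u.
Proof.
by rewrite /enorm dotZl dotZr mulrA sqrtrM -?expr2 ?sqr_ge0// sqrtr_sqr.
Qed.

Lemma enormN u : enorm (- u) = enorm u.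
Proof. by rewrite -scaleN1r enormZ normrN1 mul1r. Qed.

(** For nonzero [u], [v]: expand the squared norm of [|v| u - |u| v], which is nonnegative, and
    divide by [2 |u| |v|]. *)
Lemma dot_le_enorm u v : dot u v <= enorm u * enorm v.
Proof.
have [->|u0] := eqVneq u 0; first by rewrite dot0l enorm0 mul0r.
have [->|v0] := eqVneq v 0; first by rewrite dotC dot0l enorm0 mulr0.
have := dot_ge0 (enorm v *: u - enorm u *: v).
rewrite !(dotDl, dotDr) -!scaleNr !(dotZl, dotZr) -!enorm_sqr (dotC v u).
move: u0 v0; rewrite -!enorm_gt0.
move: (dot u v) (enorm u) (enorm v) => p a b a0 b0 h.
have {}h : 0 <= (2 * (a * b)) * (a * b - p) by lra.
by move: h; rewrite pmulr_rge0 ?subr_ge0 // !mulr_gt0.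
Qed.

Lemma cauchy_schwarz u v : `|dot u v| <= enorm u * enorm v.
Proof.
by rewrite ler_norml lerNl -dotNl -(enormN u) !dot_le_enorm enormN dot_le_enorm.
Qed.

Lemma enormD_sqr u v :
  enorm (u + v) ^+ 2 = enorm u ^+ 2 + 2 * dot u v + enorm v ^+ 2.
Proof. by rewrite !enorm_sqr dotDl !dotDr (dotC v u); ring. Qed.

Lemma ler_enormD u v : enorm (u + v) <= enorm u + enorm v.
Proof.
rewrite -(ler_pXn2r (n := 2)) ?nnegrE ?addr_ge0 ?enorm_ge0 //.
by rewrite enormD_sqr; have := dot_le_enorm u v; lra.
Qed.

(* AM-GM: [2 a |v + h| <= a^2 + |v + h|^2] with [a = |v|]. *)
Lemma enormD_le v h : v != 0 ->
  enorm (v + h) <= enorm v + dot v h / enorm v + enorm h ^+ 2 / (2 * enorm v).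
Proof.
rewrite -enorm_gt0 => v0.
have -> : enorm v + dot v h / enorm v + enorm h ^+ 2 / (2 * enorm v) =
    (enorm v ^+ 2 + enorm (v + h) ^+ 2) / (2 * enorm v).
  by rewrite enormD_sqr; field; rewrite gt_eqF.
rewrite ler_pdivlMr ?mulr_gt0 //.
by have := sqr_ge0 (enorm v - enorm (v + h)); lra.
Qed.

(** Tangent-plane bound for the convex function [enorm]; it is Cauchy-Schwarz for [v] and
    [v + h]. *)
Lemma enormD_ge v h : v != 0 -> enorm v + dot v h / enorm v <= enorm (v + h).
Proof.
rewrite -enorm_gt0 => v0.
have -> : enorm v + dot v h / enorm v = dot v (v + h) / enorm v.
  by rewrite dotDr -enorm_sqr; field; rewrite gt_eqF.
by rewrite ler_pdivrMr // mulrC dot_le_enorm.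
Qed.

Lemma enorm_le_coord u k : 0 <= k -> (forall i, `|u 0 i| <= k) ->
  enorm u <= Num.sqrt m%:R * k.
Proof.
move=> k0 uk; rewrite -{1}(ger0_norm k0) -sqrtr_sqr -sqrtrM ?ler0n //.
apply: ler_wsqrtr; rewrite mulr_natl -[X in _ *+ X]card_ord -sumr_const.
by apply: ler_sum => i _; rewrite -expr2 -real_normK ?num_real // ler_pXn2r ?nnegrE.
Qed.

Lemma enorm_continuous (T : topologicalType) (f : T -> 'rV[R]_m) :
  (forall i, continuous (fun x => f x 0 i)) -> continuous (fun x => enorm (f x)).
Proof.
move=> cf x; rewrite /enorm.
apply: (@continuous_comp _ _ _ (fun x => dot (f x) (f x)) (@Num.sqrt R));
  last exact: sqrt_continuous.
rewrite /dot; apply: cvg_big => [|i _]; first exact: add_continuous.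
by apply: cvgM; exact: cf.
Qed.

Lemma enormB_continuous (p : 'rV[R]_m) :
  continuous (fun x : 'rV[R]_m => enorm (x - p)).
Proof.
apply: enorm_continuous => i x.
rewrite (_ : (fun _ => _) = fun y : 'rV[R]_m => y 0 i - p 0 i).
  2: by apply/funext => y; rewrite !mxE.
exact: (cvgB (@coord_continuous R 1 m 0 i x) (cvg_cst (p 0 i))).
Qed.

Lemma closed_eball_closed (p : 'rV[R]_m) (rho : R) : closed (closed_eball p rho).
Proof.
apply: (@preimage_closed _ _ (fun x : 'rV[R]_m => enorm (x - p)) [set t | t <= rho]).
  by move=> x _; exact: enormB_continuous.
exact: closed_le.
Qed.

(** The subtracted term is the source of the uniform convexity of Euclidean balls. *)
Lemma enorm_conv_sqr (t : R) u v :
  enorm (t *: u + (1 - t) *: v) ^+ 2 =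
  t * enorm u ^+ 2 + (1 - t) * enorm v ^+ 2 - t * (1 - t) * enorm (u - v) ^+ 2.
Proof.
rewrite !enorm_sqr -[- v]scaleN1r !(dotDl, dotDr) !(dotZl, dotZr) (dotC v u).
by ring.
Qed.

End Euclidean.

(** * Local behaviour of the range map: Gram bound, expansion, descent *)

Section RangeMap.
Variables (R : realType) (m n : nat) (r : 'I_n -> 'rV[R]_m).
Implicit Types (x y z h : 'rV[R]_m).

(** Diagonal dominance, proved termwise: each off-diagonal term is at least
    [- mu (w_i^2 + w_j^2) / 2]. *)
Lemma gram_lower_bound (e : 'I_n -> 'rV[R]_m) (mu : R) (w : 'rV[R]_n) :
    (forall i, dot (e i) (e i) = 1) ->
    (forall i j, i != j -> `|dot (e i) (e j)| <= mu) ->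
  (1 - (n%:R - 1) * mu) * dot w w <=
  dot (\sum_i w 0 i *: e i) (\sum_i w 0 i *: e i).
Proof.
move=> e1 emu; rewrite dot_suml.
have sumc (a : R) : \sum_(i < n) a = n%:R * a.
  by rewrite sumr_const card_ord mulr_natl.
(* [T i j] minorises the [(i, j)] term of the double sum. The [1 + mu] makes [T i i] exactly
   [w_i^2], so the subtracted part can be summed over all pairs. *)
pose T i j := (w 0 i) ^+ 2 * (1 + mu) *+ (i == j)
  - mu * ((w 0 i) ^+ 2 + (w 0 j) ^+ 2) / 2.
have -> : (1 - (n%:R - 1) * mu) * dot w w = \sum_i \sum_j T i j.
  have -> : \sum_i \sum_j T i j = \sum_i (w 0 i ^+ 2 * (1 + mu) -
      (n%:R * (mu / 2 * w 0 i ^+ 2) + mu / 2 * dot w w)).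
    apply: eq_bigr => i _; rewrite /T sumrB; congr (_ - _).
      rewrite (bigD1 i) //= eqxx mulr1n big1 ?addr0 // => j /negPf ji.
      by rewrite eq_sym ji mulr0n.
    rewrite -sumc /dot mulr_sumr -big_split; apply: eq_bigr => j _ /=.
    by rewrite -expr2; field.
  rewrite sumrB big_split /= sumc -!mulr_sumr -mulr_suml.
  rewrite (_ : \sum_i w 0 i ^+ 2 = dot w w); last exact: eq_bigr.
  by field.
apply: ler_sum => i _.
rewrite dotC dot_suml; apply: ler_sum => j _.
rewrite dotZr dotZl /T.
have [<-|ij] := eqVneq i j; first by rewrite e1 mulr1n; lra.
rewrite mulr0n add0r dotC.
have := emu _ _ ij; move: (dot _ _) => p; rewrite ler_norml => /andP[p1 p2].
(* [(mu + p) (w_i + w_j)^2 + (mu - p) (w_i - w_j)^2 >= 0] is four times the required inequality up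
   to rearrangement. *)
have mup : 0 <= mu + p by lra.
have mum : 0 <= mu - p by lra.
have := mulr_ge0 mup (sqr_ge0 (w 0 i + w 0 j)).
have := mulr_ge0 mum (sqr_ge0 (w 0 i - w 0 j)).
by lra.
Qed.

Lemma dot_unit_dir (p x : 'rV[R]_m) : x != p ->
  dot (unit_dir p x) (unit_dir p x) = 1.
Proof.
rewrite -subr_eq0 -enorm_gt0 => xp.
by rewrite dotZl dotZr -enorm_sqr; field; rewrite gt_eqF.
Qed.

(** The remainder is nonnegative by convexity and bounded above by AM-GM, with [1 / |v| <= 1 / d].
    No bound on [h] is involved. *)
Lemma enorm_expansion (v h : 'rV[R]_m) (d : R) : 0 < d -> d <= enorm v ->
  0 <= enorm (v + h) - (enorm v + dot v h / enorm v) <= enorm h ^+ 2 / (2 * d).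
Proof.
move=> d0 dv; have v0 : 0 < enorm v by exact: lt_le_trans dv.
have vn0 : v != 0 by rewrite -enorm_gt0.
rewrite subr_ge0 enormD_ge //= lerBlDl (le_trans (enormD_le h vn0)) //.
rewrite lerD2l ler_wpM2l ?sqr_ge0 // lef_pV2 ?posrE ?mulr_gt0 //.
by rewrite ler_pM2l.
Qed.

(** The row added to [range_map r x] is the Jacobian applied to [h]; the factor [sqrt n] passes from
    coordinatewise bounds to the Euclidean norm. *)
Lemma range_map_expansion (d : R) x h :
    0 < d -> (forall i, d <= enorm (x - r i)) ->
  enorm (range_map r (x + h) -
    (range_map r x + \row_i dot (unit_dir (r i) x) h))
  <= Num.sqrt n%:R * (enorm h ^+ 2 / (2 * d)).
Proof.
move=> d0 dx; apply: enorm_le_coord => [|i].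
  by rewrite divr_ge0 ?sqr_ge0 ?mulr_ge0 // ltW.
rewrite !mxE addrAC dotZl [_^-1 * _]mulrC.
by have /andP[a b] := enorm_expansion h d0 (dx i); rewrite ger0_norm.
Qed.

(** Both [|x - r_i|] and [|y - r_i|] are expanded around [z]: the first-order terms cancel, and the
    second-order weights add up to [t (1 - t)^2 + (1 - t) t^2 = t (1 - t)]. *)
Lemma range_map_conv_error (d t : R) x y :
    let z := t *: x + (1 - t) *: y in
    0 < d -> (forall i, d <= enorm (z - r i)) -> 0 <= t <= 1 ->
  enorm (range_map r z - (t *: range_map r x + (1 - t) *: range_map r y))
  <= Num.sqrt n%:R * (t * (1 - t) * enorm (x - y) ^+ 2 / (2 * d)).
Proof.
move=> z d0 dz /andP[t0 t1].
have t1' : 0 <= 1 - t by rewrite subr_ge0.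
apply: enorm_le_coord => [|i].
  by rewrite divr_ge0 ?mulr_ge0 ?enorm_ge0 // ltW.
rewrite !mxE.
have -> : x - r i = (z - r i) + (1 - t) *: (x - y).
  by apply/rowP => k; rewrite !mxE; ring.
have -> : y - r i = (z - r i) + (- t) *: (x - y).
  by apply/rowP => k; rewrite !mxE; ring.
have /andP[] := enorm_expansion ((1 - t) *: (x - y)) d0 (dz i).
have /andP[] := enorm_expansion ((- t) *: (x - y)) d0 (dz i).
rewrite !dotZr !enormZ normrN (ger0_norm t0) (ger0_norm t1') !exprMn.
have -> : (1 - t) ^+ 2 * enorm (x - y) ^+ 2 / (2 * d) =
   (1 - t) * ((1 - t) * (enorm (x - y) ^+ 2 / (2 * d))) by ring.
have -> : t ^+ 2 * enorm (x - y) ^+ 2 / (2 * d) =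
   t * (t * (enorm (x - y) ^+ 2 / (2 * d))) by ring.
have -> : t * (1 - t) * enorm (x - y) ^+ 2 / (2 * d) =
   t * ((1 - t) * (enorm (x - y) ^+ 2 / (2 * d))) by ring.
rewrite -!mulrA.
move: (enorm (x - y) * (enorm (x - y) / _)) (dot _ _ / _) => q p.
move: (enorm (_ + - t *: _)) (enorm (_ + (1 - t) *: _)) (enorm (z - r i)).
move=> b a v b0 bq a0 aq.
have := mulr_ge0 t0 a0; have := mulr_ge0 t1' b0.
move: aq bq; rewrite -subr_ge0 => /(mulr_ge0 t0) aq.
rewrite -subr_ge0 => /(mulr_ge0 t1') bq.
by rewrite ler_norml => u1 u2; apply/andP; split; lra.
Qed.

(** Chooses the descent step size. Adding 1 keeps the denominators positive when [a] or [b] is 0 and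
    makes the first bound strict. *)
Lemma small_step (a b p q : R) : 0 <= a -> 0 <= b -> 0 < p -> 0 < q ->
  exists2 s, 0 < s & s * a < p /\ s * b <= q.
Proof.
move=> a0 b0 p0 q0.
have a1 : 0 < a + 1 by lra.
have b1 : 0 < b + 1 by lra.
exists (Num.min (p / (a + 1)) (q / (b + 1))).
  by rewrite lt_min !divr_gt0.
split.
  apply: (@le_lt_trans _ _ (p / (a + 1) * a)).
    by rewrite ler_wpM2r // ge_min lexx.
  by rewrite mulrAC ltr_pdivrMr // ltr_pM2l //; lra.
apply: (@le_trans _ _ (q / (b + 1) * b)).
  by rewrite ler_wpM2r // ge_min lexx orbT.
by rewrite mulrAC ler_pdivrMr // ler_pM2l //; lra.
Qed.

(* The step goes along [h = J^T g] with [g = y - F(z)], for which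
   [<g, J h> = |h|^2] and [|h| >= sqrt lam * |g| > k * |g|]. *)
Lemma range_map_descent (d lam k eps : R) z (y : 'rV[R]_n) :
    0 < d -> (forall i, d <= enorm (z - r i)) ->
    (forall w : 'rV[R]_n, lam * dot w w <=
      enorm (\sum_i w 0 i *: unit_dir (r i) z) ^+ 2) ->
    0 <= k -> k ^+ 2 < lam -> range_map r z != y -> 0 < eps ->
  exists2 z', enorm (z' - z) <= eps &
    enorm (range_map r z' - y) + k * enorm (z' - z) < enorm (range_map r z - y).
Proof.
move=> d0 dz gram k0 klam zy eps0.
(* [g] is taken here with the sign of [F(z) - y], so [h] carries the minus sign. *)
pose g := range_map r z - y.
pose h := - \sum_i g 0 i *: unit_dir (r i) z.
pose Jh : 'rV[R]_n := \row_i dot (unit_dir (r i) z) h.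
have g0 : g != 0 by rewrite subr_eq0.
have eg0 : 0 < enorm g by rewrite enorm_gt0.
have gJh : dot g Jh = - enorm h ^+ 2.
  rewrite enorm_sqr {1}/h dotNl opprK dot_suml; apply: eq_bigr => i _.
  by rewrite dotZl [Jh 0 i]mxE.
have kh : k * enorm g < enorm h.
  rewrite -(ltr_pXn2r (n := 2)) ?nnegrE ?enorm_ge0 ?(mulr_ge0 k0) ?enorm_ge0 //.
  rewrite exprMn enormN; apply: lt_le_trans (gram g).
  by rewrite -enorm_sqr ltr_pM2r ?exprn_gt0.
have eh0 : 0 < enorm h by apply: le_lt_trans kh; rewrite mulr_ge0 // enorm_ge0.
(* Coefficient of [s^2]: one part from the norm at [g + s Jh], the other from the expansion of the
   range map. *)
pose C := enorm Jh ^+ 2 / (2 * enorm g)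
  + Num.sqrt n%:R * (enorm h ^+ 2 / (2 * d)).
have C0 : 0 <= C.
  apply: addr_ge0; last apply: mulr_ge0 (sqrtr_ge0 _) _;
    by apply: divr_ge0; rewrite ?sqr_ge0 // mulr_ge0 // ltW.
(* First-order rate of decrease [|h|^2 / |g| - k |h|], the penalty [k |z' - z|] included; it
   dominates once [s C < P]. *)
have P0 : 0 < enorm h * ((enorm h - k * enorm g) / enorm g).
  by rewrite mulr_gt0 // divr_gt0 // subr_gt0.
have [s s0 [sC sh]] := small_step C0 (ltW eh0) P0 eps0.
exists (z + s *: h); rewrite addrAC subrr add0r enormZ gtr0_norm //.
have := range_map_expansion (s *: h) d0 dz.
have -> : \row_i dot (unit_dir (r i) z) (s *: h) = s *: Jh.
  by apply/rowP => i; rewrite !mxE dotZr.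
move: (range_map r (z + _)) => F' err.
have -> : F' - y = (g + s *: Jh) + (F' - (range_map r z + s *: Jh)).
  by apply/rowP => i; rewrite !mxE; ring.
set P := enorm h * _ in P0 sC.
apply: (@le_lt_trans _ _ (enorm g + s * (s * C - P))); last first.
  by rewrite gtrDl pmulr_rlt0 // subr_lt0.
have -> : enorm g + s * (s * C - P) =
    (enorm g + (- (s * enorm h ^+ 2)) / enorm g
      + s ^+ 2 * enorm Jh ^+ 2 / (2 * enorm g))
    + Num.sqrt n%:R * ((s * enorm h) ^+ 2 / (2 * d)) + k * (s * enorm h).
  by rewrite /C /P; field; rewrite !gt_eqF.
rewrite lerD2r; apply: le_trans (ler_enormD _ _) _; apply: lerD.
  apply: le_trans (enormD_le _ g0) _.
  by rewrite dotZr gJh enormZ exprMn gtr0_norm // mulrN.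
by move: err; rewrite enormZ gtr0_norm.
Qed.

End RangeMap.

(* At a minimiser of [|f z - y| + k |z - x0|] other than a solution, a descent
   step would lower the value; comparison with [x0] keeps it off the sphere. *)
Lemma closed_eball_covering (R : realType) (m n : nat)
    (f : 'rV[R]_m -> 'rV[R]_n) (x0 : 'rV[R]_m) (y : 'rV[R]_n) (delta k : R) :
    compact (closed_eball x0 delta) ->
    continuous (fun z => enorm (f z - y)) ->
    0 < k -> enorm (f x0 - y) < k * delta ->
    (forall z eps, enorm (z - x0) < delta -> f z != y -> 0 < eps ->
      exists2 z', enorm (z' - z) <= eps &
        enorm (f z' - y) + k * enorm (z' - z) < enorm (f z - y)) ->
  exists2 z, closed_eball x0 delta z & f z = y.
Proof.
move=> cK cf k0 x0y descent.
have delta0 : 0 < delta.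
  by rewrite -(pmulr_rgt0 _ k0); apply: le_lt_trans x0y; exact: enorm_ge0.
have Kx0 : closed_eball x0 delta x0.
  by rewrite /closed_eball /= subrr enorm0 ltW.
pose g z := enorm (f z - y) + k * enorm (z - x0).
have cg : continuous g.
  move=> z.
  exact: (cvgD (cf z) (cvgM (cvg_cst k) (@enormB_continuous _ _ x0 z))).
have K0 : closed_eball x0 delta !=set0 by exists x0.
have [z /set_mem Kz zmin] := compact_EVT_min K0 cK (continuous_subspaceT cg).
have [fzy|fzy] := eqVneq (f z) y; first by exists z.
have zdelta : enorm (z - x0) < delta.
  rewrite -(ltr_pM2l k0); apply: le_lt_trans x0y.
  have := zmin _ (mem_set Kx0); rewrite /g subrr enorm0 mulr0 addr0.
  by have := enorm_ge0 (f z - y); lra.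
(* A step no longer than the remaining distance to the sphere stays in the closed ball, where [z] is
   minimal. *)
have eps0 : 0 < delta - enorm (z - x0) by rewrite subr_gt0.
have [z' z'z lt_z'] := descent z _ zdelta fzy eps0.
have tri : enorm (z' - x0) <= enorm (z' - z) + enorm (z - x0).
  by apply: le_trans (ler_enormD _ _); rewrite addrA subrK.
have Kz' : closed_eball x0 delta z' by rewrite /closed_eball /=; lra.
have := zmin _ (mem_set Kz'); rewrite /g.
by move: tri; rewrite -(ler_pM2l k0); lra.
Qed.

(** * Pointwise bounds from the distance and the coherence *)

Section DistanceCoherence.
Variables (R : realType) (m n : nat) (r : 'I_n -> 'rV[R]_m) (A : set 'rV[R]_m).

Lemma dist_to_le (p a : 'rV[R]_m) : A a -> dist_to p A <= enorm (p - a).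
Proof.
move=> Aa; apply: ge_inf; last by exists a.
by exists 0 => _ [b _ <-]; exact: enorm_ge0.
Qed.

(** By compactness the distance is bounded below by its value at a nearest point of [A], which
    differs from [p]. *)
Lemma dist_to_gt0 (p : 'rV[R]_m) : compact A -> A !=set0 -> ~ A p -> 0 < dist_to p A.
Proof.
move=> cA A0 Ap.
have [a /set_mem Aa amin] := compact_EVT_min A0 cA
  (continuous_subspaceT (@enormB_continuous R m p)).
apply: (@lt_le_trans _ _ (enorm (a - p))).
  by rewrite enorm_gt0 subr_eq0; apply/eqP => ap; rewrite ap in Aa.
apply: lb_le_inf; first by case: A0 => b Ab; exists (enorm (p - b)); exists b.
by move=> _ [b Ab <-]; rewrite -(enormN (p - b)) opprB; apply: amin; exact: mem_set.
Qed.

Lemma dist_family_le (i : 'I_n) (x : 'rV[R]_m) : A x ->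
  dist_family r A <= enorm (x - r i).
Proof.
move=> Ax; rewrite -enormN opprB; apply: le_trans (dist_to_le _ Ax).
apply: ge_inf; last by exists i.
exists 0 => _ [j _ <-]; apply: lb_le_inf.
  by exists (enorm (r j - x)); exists x.
by move=> _ [b _ <-]; exact: enorm_ge0.
Qed.

Lemma dist_family_gt0 : (0 < n)%N -> compact A -> A !=set0 ->
  (forall i, ~ A (r i)) -> 0 < dist_family r A.
Proof.
move=> n0 cA A0 Ar; pose i0 := Ordinal n0.
pose j := [arg min_(i < i0) dist_to (r i) A]%O.
apply: (@lt_le_trans _ _ (dist_to (r j) A)); first exact: dist_to_gt0.
apply: lb_le_inf; first by exists (dist_to (r i0) A); exists i0.
move=> _ [i _ <-]; rewrite /j.
by case: Order.TotalTheory.arg_minP => // k _; exact.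
Qed.

(** Includes [x = p], where the vector is 0; thus the set defining the coherence is bounded by 1 for
    every [A]. *)
Lemma enorm_unit_dir_le1 (p x : 'rV[R]_m) : enorm (unit_dir p x) <= 1.
Proof.
have [->|xp] := eqVneq x p; first by rewrite /unit_dir subrr scaler0 enorm0.
by rewrite /enorm dot_unit_dir // sqrtr1.
Qed.

Lemma mutual_coherence_ge (x : 'rV[R]_m) (i j : 'I_n) : A x -> i != j ->
  `|dot (unit_dir (r i) x) (unit_dir (r j) x)| <= mutual_coherence r A.
Proof.
move=> Ax ij; apply: ub_le_sup; last by exists x, i, j.
exists 1 => _ [z [k [l [_ _ ->]]]]; apply: le_trans (cauchy_schwarz _ _) _.
by rewrite mulr_ile1 ?enorm_ge0 ?enorm_unit_dir_le1.
Qed.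

Lemma mutual_coherence_ge0 : 0 <= mutual_coherence r A.
Proof.
rewrite /mutual_coherence; set S := (X in sup X).
(* Without a pair [i != j], as for a single point, the supremum takes its default value 0. *)
have [->|/set0P[t [x [i [j [Ax ij _]]]]]] := eqVneq S set0; first by rewrite sup0.
by apply: le_trans (mutual_coherence_ge Ax ij).
Qed.

Lemma range_mapB_continuous (y : 'rV[R]_n) :
  continuous (fun x => enorm (range_map r x - y)).
Proof.
apply: enorm_continuous => i x.
rewrite (_ : (fun _ => _) = fun x : 'rV[R]_m => enorm (x - r i) - y 0 i).
  2: by apply/funext => z; rewrite !mxE.
exact: (cvgB (@enormB_continuous _ _ _ x) (cvg_cst (y 0 i))).
Qed.

End DistanceCoherence.

(** * Uniform convexity of Euclidean balls *)

(** With [p] the convex combination, AM-GM gives [2 rho |p - a| <= |p - a|^2 + rho^2], and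
    [|p - a|^2] contains [- q], which absorbs the radius [q / (2 rho)]. *)
Lemma eball_uniformly_convex (R : realType) (m : nat) (B : set 'rV[R]_m)
    (a x y : 'rV[R]_m) (rho t : R) :
    0 < rho -> B = open_eball a rho \/ B = closed_eball a rho ->
    B x -> B y -> 0 <= t <= 1 ->
  closed_eball (t *: x + (1 - t) *: y)
    (t * (1 - t) * enorm (x - y) ^+ 2 / (2 * rho)) `<=` B.
Proof.
move=> rho0 Bdef Bx By /andP[t0 t1] z; rewrite /closed_eball /=.
set p := t *: x + _; set q := t * _ * _ => zp.
have q_id : enorm (p - a) ^+ 2 =
    t * enorm (x - a) ^+ 2 + (1 - t) * enorm (y - a) ^+ 2 - q.
  have -> : p - a = t *: (x - a) + (1 - t) *: (y - a).
    by apply/rowP => k; rewrite !mxE; ring.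
  rewrite enorm_conv_sqr /q; congr (_ - _ * enorm _ ^+ 2).
  by rewrite opprB addrA subrK.
have za : enorm (z - a) <=
    (t * enorm (x - a) ^+ 2 + (1 - t) * enorm (y - a) ^+ 2 + rho ^+ 2) / (2 * rho).
  apply: le_trans (_ : enorm (z - p) + enorm (p - a) <= _).
    by apply: le_trans (ler_enormD _ _); rewrite addrA subrK.
  apply: le_trans (lerD zp (lexx _)) _.
  rewrite -lerBrDl -mulrBl ler_pdivlMr ?mulr_gt0 //.
  by have := sqr_ge0 (enorm (p - a) - rho); rewrite sqrrB q_id; lra.
have t1' : 0 <= 1 - t by rewrite subr_ge0.
case: Bdef Bx By => ->; rewrite /open_eball /closed_eball /= => xa ya.
  apply: le_lt_trans za _; rewrite ltr_pdivrMr ?mulr_gt0 //.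
  have xa2 : enorm (x - a) ^+ 2 < rho ^+ 2.
    by rewrite ltr_pXn2r ?nnegrE ?enorm_ge0 ?ltW.
  have ya2 : enorm (y - a) ^+ 2 < rho ^+ 2.
    by rewrite ltr_pXn2r ?nnegrE ?enorm_ge0 ?ltW.
  (* Strictness comes from [x] if [t > 0] and from [y] if [t = 0]. *)
  have [t00|t00] := ltrP 0 t.
    move: xa2; rewrite -(ltr_pM2l t00); by have := ler_wpM2l t1' (ltW ya2); lra.
  have -> : t = 0 by lra.
  by lra.
apply: le_trans za _; rewrite ler_pdivrMr ?mulr_gt0 //.
have xa2 : enorm (x - a) ^+ 2 <= rho ^+ 2.
  by rewrite ler_pXn2r ?nnegrE ?enorm_ge0 // ltW.
have ya2 : enorm (y - a) ^+ 2 <= rho ^+ 2.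
  by rewrite ler_pXn2r ?nnegrE ?enorm_ge0 // ltW.
by have := ler_wpM2l t1' ya2; have := ler_wpM2l t0 xa2; lra.
Qed.

(** * Convexity of the image of the ball *)

Theorem theorem3 (R : realType) (m : nat)
    (A : set 'rV[R]_m) (A_compact : compact A)
    (r : 'I_m -> 'rV[R]_m) (r_indep : affinely_independent r)
    (u : 'rV[R]_m) (c : R) (u_neq0 : u != 0)
    (Aff_r : Aff r = hyperplane u c)
    (A_side : A `<=` halfspace_neg u c \/ A `<=` halfspace_pos u c)
    (B : set 'rV[R]_m) (a : 'rV[R]_m) (rho : R) (rho_gt0 : 0 < rho)
    (B_ball : B = open_eball a rho \/ B = closed_eball a rho)
    (B_sub_A : B `<=` A)
    (rho_small : rho / dist_family r A
       < (1 - (m%:R - 1) * mutual_coherence r A) / Num.sqrt m%:R) :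
  convex_set (range_map r @` B).
Proof.
(* In dimension 0 the normal vector [u] would be 0. *)
have m_gt0 : (0 < m)%N.
  rewrite lt0n; apply: contra_neq u_neq0 => m0.
  by apply/rowP => i; move: (ltn_ord i); rewrite [X in (_ < X)%N]m0.
have r_notin_A i : ~ A (r i).
  have : Aff r (r i).
    exists (fun j => (j == i)%:R); split.
      by rewrite (bigD1 i) //= eqxx big1 ?addr0 // => j /negPf ->.
    rewrite (bigD1 i) //= eqxx scale1r big1 ?addr0 // => j /negPf ->.
    by rewrite scale0r.
  rewrite Aff_r /hyperplane /= => uri Ari.
  by case: A_side => /(_ _ Ari); rewrite /halfspace_neg /halfspace_pos /= uri ltxx.
have A_neq0 : A !=set0.
  exists a; apply: B_sub_A.
  by case: B_ball => ->; rewrite /open_eball /closed_eball /= subrr enorm0 ?ltW.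
have d_gt0 := dist_family_gt0 m_gt0 A_compact A_neq0 r_notin_A.
set d := dist_family r A in rho_small d_gt0.
have d_le x i : A x -> d <= enorm (x - r i) by exact: dist_family_le.
set mu := mutual_coherence r A in rho_small.
set lam := 1 - (m%:R - 1) * mu in rho_small.
have sm_gt0 : 0 < Num.sqrt m%:R :> R by rewrite sqrtr_gt0 ltr0n.
have lam_le1 : lam <= 1.
  by rewrite gerBl mulr_ge0 ?mutual_coherence_ge0 // subr_ge0 ler1n.
have [k [k_gt0 k_small k_lam]] :
    exists k, [/\ 0 < k, Num.sqrt m%:R * rho / d < k & k ^+ 2 < lam].
  move: rho_small; rewrite ltr_pdivlMr // mulrC mulrA => rho_lam.
  have e_gt0 : 0 < Num.sqrt m%:R * rho / d by rewrite divr_gt0 ?mulr_gt0.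
  (* [k] is the midpoint of [sqrt m * rho / d] and [lam]; since [k < lam <= 1], also
     [k^2 <= k < lam]. *)
  have [lt1 lt2] := (midf_lt rho_lam).
  set k := (_ / 2) in lt1 lt2; exists k.
  have k_gt0 := lt_trans e_gt0 lt1; split=> //.
  by apply: (le_lt_trans _ lt2); rewrite expr2 ger_pMr // (le_trans (ltW lt2)).
move=> Fx Fy l; rewrite !inE => -[x Bx <- {Fx}] [y By <- {Fy}].
have t01 : 0 <= l%:num <= 1 by apply/andP; split.
set t := l%:num in t01.
change (exists2 z, B z &
  range_map r z = t *: range_map r x + (1 - t) *: range_map r y).
have := eball_uniformly_convex rho_gt0 B_ball Bx By t01.
set z := t *: x + _; set q := t * _ * _ => K_sub_B.
have q_ge0 : 0 <= q.
  by case/andP: t01 => t0 t1; rewrite !mulr_ge0 ?subr_ge0 ?enorm_ge0.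
have Bz : B z.
  apply: K_sub_B; rewrite /closed_eball /= subrr enorm0.
  by rewrite divr_ge0 // mulr_ge0 // ltW.
have err := range_map_conv_error d_gt0 (fun i => d_le _ i (B_sub_A _ Bz)) t01.
rewrite -/z -/q in err; set w := t *: range_map r x + _ in err *.
(* For [q = 0] the ball around [z] degenerates, but the error bound already forces [F z = w]. *)
have [q0|q_neq0] := eqVneq q 0.
  exists z => //; apply/eqP; rewrite -subr_eq0 -enorm_eq0 eq_le enorm_ge0 andbT.
  by move: err; rewrite q0 mul0r mulr0.
have q_gt0 : 0 < q by rewrite lt_def q_neq0.
have K_sub_A := subset_trans K_sub_B B_sub_A.
(* Compactness is inherited from [A], as the ball is closed and contained in [A]. *)
have K_compact := subclosed_compact
  (@closed_eball_closed R m z (q / (2 * rho))) A_compact K_sub_A.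
have err_lt : enorm (range_map r z - w) < k * (q / (2 * rho)).
  apply: le_lt_trans err _.
  (* The error is rewritten as a multiple of the radius [q / (2 rho)], with a factor below [k]. *)
  rewrite (_ : Num.sqrt _ * _ = (Num.sqrt m%:R * rho / d) * (q / (2 * rho))).
    by rewrite ltr_pM2r // divr_gt0 // mulr_gt0.
  by field; rewrite !gt_eqF.
have [|z' Kz' Fz'] := closed_eball_covering K_compact
    (@range_mapB_continuous _ _ _ r w) k_gt0 err_lt.
  move=> v eps v_in Fv eps_gt0.
  (* Membership in [A] makes the bounds by [d] and [mu] available at [v]. *)
  have Av : A v by apply: K_sub_A; exact: ltW.
  apply: (range_map_descent d_gt0 _ _ (ltW k_gt0) k_lam Fv eps_gt0).
    by move=> i; exact: d_le.
  move=> g; rewrite enorm_sqr; apply: gram_lower_bound => [i|i j ij].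
    by apply: dot_unit_dir; apply/eqP => vri; apply: (r_notin_A i); rewrite -vri.
  exact: mutual_coherence_ge.
by exists z' => //; exact: K_sub_B.
Qed.
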